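(* Let $\Sigma$ be a CAMC surface (surface with constant anisotropic mean curvature $\Lambda\in\mathbb{R}$) of the Dirichlet energy in $\mathbb{R}^3$. If $\Sigma$ is a surface of revolution, then its rotation axis is parallel to the $z$-axis.
   Context: Let $\Sigma$ be an oriented surface immersed in Euclidean space $\mathbb{R}^3$ (coordinates $(x,y,z)$) with unit normal $\nu=(\nu_1,\nu_2,\nu_3)$. The Dirichlet energy of $\Sigma$ is $\mathcal{F}(\Sigma)=\int_\Sigma F(\nu)\,d\Sigma$ with $F(\nu)=\frac{1}{\nu_3}-\nu_3$, where it is understood that $\nu_3\neq 0$; if $\Sigma$ is the graph $z=u(x,y)$ over $\Omega\subset\mathbb{R}^2$, this equals $\int_\Omega|Du|^2$. The anisotropic mean curvature of $\Sigma$ is $\Lambda=2HF-\mathrm{div}_\Sigma DF$, where $H$ is the mean curvature of $\Sigma$ and $DF$ is the gradient of $F$ on the unit sphere $\mathbb{S}^2$. $\Sigma$ is a CAMC (stationary) surface if $\Lambda$ is constant. For a graph $z=u(x,y)$, the condition of having constant anisotropic mean curvature $\Lambda$ reads $u_{xx}+u_{yy}=\Lambda/2$.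
   Formalization: Surfaces contained in a non-horizontal plane are excluded: such a plane (e.g. z = x) has Λ = 0 and is a surface of revolution about any of its normal lines, which are not parallel to the z-axis, so the claim fails for it. *)

(* Defs.v *)
From Stdlib Require Import Reals.
From Coquelicot Require Import Coquelicot.

Open Scope R_scope.

(** Euclidean space of dimension three; sums and multiples are Coquelicot's
    [plus] and [scal] on [R * R * R]. *)
Notation R3 := (R * R * R)%type.

Definition cx (v : R3) : R := fst (fst v).
Definition cy (v : R3) : R := snd (fst v).
Definition cz (v : R3) : R := snd v.

Definition e_z : R3 := (0, 0, 1).

Definition dot (v w : R3) : R := cx v * cx w + cy v * cy w + cz v * cz w.

Definition cross (v w : R3) : R3 :=
  (cy v * cz w - cz v * cy w,
   cz v * cx w - cx v * cz w,
   cx v * cy w - cy v * cx w).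

(** Meant for a nonzero [v]. *)
Definition parallel (v w : R3) : Prop := exists c : R, v = scal c w.

Definition orthonormal (a b c : R3) : Prop :=
  dot a a = 1 /\ dot b b = 1 /\ dot c c = 1 /\
  dot a b = 0 /\ dot a c = 0 /\ dot b c = 0.

Definition pd1 (f : R -> R -> R) (u v : R) : R := Derive (fun s => f s v) u.
Definition pd2 (f : R -> R -> R) (u v : R) : R := Derive (fun s => f u s) v.

(** Class C^k on [D], a subset of the plane that is open in all uses below, so
    that the partial derivatives at the points of [D] only depend on the
    restriction of [f] to [D]. *)
Fixpoint Ck (k : nat) (D : R -> R -> Prop) (f : R -> R -> R) : Prop :=
  (forall u v, D u v -> continuity_2d_pt f u v) /\
  match k with
  | O => True
  | S k' =>
      (forall u v, D u v ->
         ex_derive (fun s => f s v) u /\ ex_derive (fun s => f u s) v) /\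
      Ck k' D (pd1 f) /\ Ck k' D (pd2 f)
  end.

Definition smooth2 (D : R -> R -> Prop) (f : R -> R -> R) : Prop :=
  forall k : nat, Ck k D f.

Definition smooth_field (D : R -> R -> Prop) (X : R -> R -> R3) : Prop :=
  smooth2 D (fun u v => cx (X u v)) /\
  smooth2 D (fun u v => cy (X u v)) /\
  smooth2 D (fun u v => cz (X u v)).

Definition vpd1 (X : R -> R -> R3) (u v : R) : R3 :=
  (pd1 (fun s t => cx (X s t)) u v,
   pd1 (fun s t => cy (X s t)) u v,
   pd1 (fun s t => cz (X s t)) u v).

Definition vpd2 (X : R -> R -> R3) (u v : R) : R3 :=
  (pd2 (fun s t => cx (X s t)) u v,
   pd2 (fun s t => cy (X s t)) u v,
   pd2 (fun s t => cz (X s t)) u v).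

(** Surfaces are smooth immersions [X] of an open set [D] of parameters (not
    necessarily injective), oriented by a smooth unit normal field [nu]. *)
Definition oriented_immersion (D : R -> R -> Prop) (X nu : R -> R -> R3) : Prop :=
  open (fun q : R * R => D (fst q) (snd q)) /\
  smooth_field D X /\
  (forall u v, D u v -> cross (vpd1 X u v) (vpd2 X u v) <> zero) /\
  smooth_field D nu /\
  (forall u v, D u v ->
     dot (nu u v) (nu u v) = 1 /\
     dot (nu u v) (vpd1 X u v) = 0 /\
     dot (nu u v) (vpd2 X u v) = 0).

(** The divergence along the surface of a vector field [W] of R^3 defined on
    it: the trace [sum_ij g^ij <W_i, X_j>], where [g^ij] is the inverse of the
    first fundamental form. *)
Definition surface_div (X W : R -> R -> R3) (u v : R) : R :=
  let X1 := vpd1 X u v in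
  let X2 := vpd2 X u v in
  let W1 := vpd1 W u v in
  let W2 := vpd2 W u v in
  let g11 := dot X1 X1 in
  let g12 := dot X1 X2 in
  let g22 := dot X2 X2 in
  (g22 * dot W1 X1 - g12 * (dot W1 X2 + dot W2 X1) + g11 * dot W2 X2)
  / (g11 * g22 - g12 ^ 2).

(** Half the trace of the shape operator [- d nu]; with this sign the upward
    oriented graph of a convex function has [0 <= H]. *)
Definition mean_curvature (X nu : R -> R -> R3) (u v : R) : R :=
  - surface_div X nu u v / 2.

Definition grad3 (F : R3 -> R) (n : R3) : R3 :=
  (Derive (fun s => F (s, cy n, cz n)) (cx n),
   Derive (fun s => F (cx n, s, cz n)) (cy n),
   Derive (fun s => F (cx n, cy n, s)) (cz n)).

(** The gradient on the unit sphere, at [n], of the restriction of [F]: the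
    part of the Euclidean gradient that is orthogonal to [n]. *)
Definition sphere_grad (F : R3 -> R) (n : R3) : R3 :=
  plus (grad3 F n) (scal (- dot (grad3 F n) n) n).

Definition aniso_mean_curvature (F : R3 -> R) (X nu : R -> R -> R3) (u v : R) : R :=
  2 * mean_curvature X nu u v * F (nu u v)
  - surface_div X (fun s t => sphere_grad F (nu s t)) u v.

Definition dirichlet_density (n : R3) : R := / cz n - cz n.

Definition dirichlet_CAMC (D : R -> R -> Prop) (X nu : R -> R -> R3) (Lambda : R) : Prop :=
  forall u v, D u v ->
    cz (nu u v) <> 0 /\
    aniso_mean_curvature dirichlet_density X nu u v = Lambda.

(** [X] is generated by the full rotation, about the line through [p] with unit
    direction [a], of the regular curve [s |-> p + t(s) a + r(s) e1] of the open
    half-plane [r > 0] bounded by that line.  Points where a surface meets its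
    axis are limits of this parametrization at an end of the interval. *)
Definition surface_of_revolution (p a : R3) (D : R -> R -> Prop) (X : R -> R -> R3) : Prop :=
  exists (lo hi : Rbar) (e1 e2 : R3) (r t : R -> R),
    let I := fun s : R => Rbar_lt lo s /\ Rbar_lt s hi in
    Rbar_lt lo hi /\
    orthonormal a e1 e2 /\
    (forall s, I s ->
       (forall n : nat, ex_derive_n r n s /\ ex_derive_n t n s) /\
       0 < r s /\
       (Derive r s <> 0 \/ Derive t s <> 0)) /\
    (forall s theta, D s theta <-> I s) /\
    (forall s theta, I s ->
       X s theta =
         plus p (plus (scal (t s) a)
                      (plus (scal (r s * cos theta) e1)
                            (scal (r s * sin theta) e2)))).

Definition lies_in_plane (D : R -> R -> Prop) (X : R -> R -> R3) (n : R3) (d : R) : Prop :=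
  n <> zero /\ forall u v, D u v -> dot n (X u v) = d.

(* Main.v *)
(** Along a parallel of a surface of revolution with profile curve [(r, t)] the
    normal is [nu = al a + mu m(theta)], with [m(theta)] the radial unit vector
    and constant [al], [mu]; the principal curvatures are constant too. Since
    [Lambda nu_3^3 = 4 H nu_3^2 + 2 <S e_z^T, e_z^T>] with [S] the shape operator,
    the CAMC equation along the parallel is a polynomial of degree three in the
    height of [m(theta)], which fills an interval when the axis is tilted. All
    its coefficients vanish, which is impossible where [t' <> 0]. Hence [t] is
    constant and the surface lies in a plane orthogonal to the axis. *)

Require Import Defs.
From Stdlib Require Import Reals Lra Classical.
From Coquelicot Require Import Coquelicot.
Open Scope R_scope.

(** * Vector algebra and orthonormal frames of three-space *)

Lemma vec_eq (v w : R3) : cx v = cx w -> cy v = cy w -> cz v = cz w -> v = w.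
Proof.
  destruct v as [[v1 v2] v3], w as [[w1 w2] w3]; unfold cx, cy, cz; simpl.
  now intros -> -> ->.
Qed.

Lemma dot_plus_r (v w w' : R3) : dot v (plus w w') = dot v w + dot v w'.
Proof. unfold dot, cx, cy, cz, plus; simpl; unfold plus; simpl; ring. Qed.

Lemma dot_scal_r (v w : R3) (k : R) : dot v (scal k w) = k * dot v w.
Proof. unfold dot, cx, cy, cz, scal; simpl; unfold scal; simpl; unfold mult; simpl; ring. Qed.

Lemma dot_comm (v w : R3) : dot v w = dot w v.
Proof. unfold dot; ring. Qed.

Lemma dot_plus_l (v v' w : R3) : dot (plus v v') w = dot v w + dot v' w.
Proof. now rewrite dot_comm, dot_plus_r, !(dot_comm w). Qed.

Lemma dot_scal_l (v w : R3) (k : R) : dot (scal k v) w = k * dot v w.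
Proof. now rewrite dot_comm, dot_scal_r, (dot_comm w). Qed.

Lemma dot_zero_r (v : R3) : dot v zero = 0.
Proof. unfold dot, cx, cy, cz, zero; simpl; unfold zero; simpl; ring. Qed.

Lemma dot_e_z (v : R3) : dot v e_z = cz v.
Proof. unfold dot, e_z, cx, cy, cz; simpl; ring. Qed.

Lemma dot_self_eq0 (v : R3) : dot v v = 0 -> v = zero.
Proof.
  unfold dot; intros H; apply vec_eq; change (cx zero) with 0;
    change (cy zero) with 0; change (cz zero) with 0; nra.
Qed.

(* The defect [u] of the expansion of [v] is orthogonal to the frame, whose
   determinant squares to the Gram determinant 1, so [u = 0] by Cramer's rule. *)
Lemma parseval (a b c v w : R3) : orthonormal a b c ->
  dot v w = dot v a * dot w a + dot v b * dot w b + dot v c * dot w c.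
Proof.
  intros (aa & bb & cc & ab & ac & bc).
  set (u := plus v (plus (scal (- dot v a) a)
                     (plus (scal (- dot v b) b) (scal (- dot v c) c)))).
  assert (ua : dot u a = 0).
  { unfold u; rewrite !dot_plus_l, !dot_scal_l, (dot_comm b a), (dot_comm c a), aa, ab, ac; ring. }
  assert (ub : dot u b = 0).
  { unfold u; rewrite !dot_plus_l, !dot_scal_l, (dot_comm c b), bb, ab, bc; ring. }
  assert (uc : dot u c = 0).
  { unfold u; rewrite !dot_plus_l, !dot_scal_l, cc, ac, bc; ring. }
  assert (gram : dot (cross a b) c * dot (cross a b) c = 1).
  { transitivity (dot a a * (dot b b * dot c c - dot b c * dot b c)
      - dot a b * (dot a b * dot c c - dot b c * dot a c)
      + dot a c * (dot a b * dot b c - dot b b * dot a c)).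
    - unfold dot, cross, cx, cy, cz; simpl; ring.
    - rewrite aa, bb, cc, ab, ac, bc; ring. }
  assert (cramer : dot (cross a b) c * dot u w
     = dot u a * dot (cross b c) w + dot u b * dot (cross c a) w
       + dot u c * dot (cross a b) w).
  { unfold dot, cross, cx, cy, cz; simpl; ring. }
  rewrite ua, ub, uc in cramer.
  assert (uw : dot u w = 0) by nra.
  unfold u in uw; rewrite !dot_plus_l, !dot_scal_l in uw.
  rewrite (dot_comm a w), (dot_comm b w), (dot_comm c w) in uw; lra.
Qed.

Lemma rotate_orthonormal (a b c : R3) (th : R) : orthonormal a b c ->
  orthonormal a (plus (scal (cos th) b) (scal (sin th) c))
                (plus (scal (- sin th) b) (scal (cos th) c)).
Proof.
  intros (aa & bb & cc & ab & ac & bc); pose proof (sin2_cos2 th) as T; unfold Rsqr in T.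
  unfold orthonormal; rewrite !dot_plus_r, !dot_plus_l, !dot_scal_r, !dot_scal_l,
    (dot_comm c b), aa, bb, cc, ab, ac, bc.
  repeat split; lra.
Qed.

(** The function [acos] only covers the upper half circle, so a negative [y] takes the opposite
    angle. *)
Lemma polar_angle (x y c : R) : 0 < c -> x * x + y * y = c * c ->
  exists th, x = c * cos th /\ y = c * sin th.
Proof.
  intros c0 H.
  assert (b : -1 <= x / c <= 1).
  { split; [apply Rle_div_r | apply Rle_div_l]; try lra; nra. }
  assert (s : c * sin (acos (x / c)) = Rabs y).
  { rewrite sin_acos by exact b.
    rewrite <- (sqrt_Rsqr c) at 1 by lra; rewrite <- sqrt_mult_alt by apply Rle_0_sqr.
    rewrite <- sqrt_Rsqr_abs; f_equal; unfold Rsqr.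
    transitivity (c * c - x * x); [field; lra | lra]. }
  assert (k : c * cos (acos (x / c)) = x) by (rewrite cos_acos by exact b; field; lra).
  destruct (Rle_dec 0 y) as [y0 | y0].
  - exists (acos (x / c)); rewrite s, k, Rabs_pos_eq by lra; auto.
  - exists (- acos (x / c)); rewrite cos_neg, sin_neg, k.
    rewrite Rabs_left in s by lra; split; lra.
Qed.

(** * Derivatives of vector-valued functions of one variable *)

Definition is_vderive (V : R -> R3) (x : R) (V' : R3) : Prop :=
  is_derive (fun s => cx (V s)) x (cx V') /\
  is_derive (fun s => cy (V s)) x (cy V') /\
  is_derive (fun s => cz (V s)) x (cz V').

Lemma is_vderive_ext_loc (V W : R -> R3) (x : R) (V' : R3) :
  locally x (fun s => V s = W s) -> is_vderive V x V' -> is_vderive W x V'.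
Proof.
  intros E (H1 & H2 & H3).
  split; [|split]; (eapply is_derive_ext_loc; [|eassumption]);
    (eapply filter_imp; [|exact E]); intros s ->; reflexivity.
Qed.

Lemma is_vderive_dot (V W : R -> R3) (x : R) (V' W' : R3) :
  is_vderive V x V' -> is_vderive W x W' ->
  is_derive (fun s => dot (V s) (W s)) x (dot V' (W x) + dot (V x) W').
Proof.
  intros (V1 & V2 & V3) (W1 & W2 & W3); unfold dot.
  replace (cx V' * cx (W x) + cy V' * cy (W x) + cz V' * cz (W x)
           + (cx (V x) * cx W' + cy (V x) * cy W' + cz (V x) * cz W'))
    with ((cx V' * cx (W x) + cx (V x) * cx W' + (cy V' * cy (W x) + cy (V x) * cy W'))
          + (cz V' * cz (W x) + cz (V x) * cz W')) by ring.
  exact (is_derive_plus _ _ _ _ _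
           (is_derive_plus _ _ _ _ _ (is_derive_mult _ _ _ _ _ V1 W1 Rmult_comm)
                                     (is_derive_mult _ _ _ _ _ V2 W2 Rmult_comm))
           (is_derive_mult _ _ _ _ _ V3 W3 Rmult_comm)).
Qed.

Lemma is_vderive_const (v : R3) (x : R) : is_vderive (fun _ => v) x zero.
Proof. split; [|split]; apply @is_derive_const. Qed.

Lemma is_vderive_plus (V W : R -> R3) (x : R) (V' W' : R3) :
  is_vderive V x V' -> is_vderive W x W' ->
  is_vderive (fun s => plus (V s) (W s)) x (plus V' W').
Proof.
  intros (V1 & V2 & V3) (W1 & W2 & W3).
  split; [|split].
  - exact (is_derive_plus _ _ _ _ _ V1 W1).
  - exact (is_derive_plus _ _ _ _ _ V2 W2).
  - exact (is_derive_plus _ _ _ _ _ V3 W3).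
Qed.

Lemma is_vderive_scal (k : R -> R) (V : R -> R3) (x k' : R) (V' : R3) :
  is_derive k x k' -> is_vderive V x V' ->
  is_vderive (fun s => scal (k s) (V s)) x (plus (scal k' (V x)) (scal (k x) V')).
Proof.
  intros Hk (V1 & V2 & V3).
  split; [|split].
  - exact (is_derive_mult _ _ _ _ _ Hk V1 Rmult_comm).
  - exact (is_derive_mult _ _ _ _ _ Hk V2 Rmult_comm).
  - exact (is_derive_mult _ _ _ _ _ Hk V3 Rmult_comm).
Qed.

Lemma is_vderive_vpd1 (X : R -> R -> R3) (u v : R) (l : R3) :
  is_vderive (fun s => X s v) u l -> vpd1 X u v = l.
Proof.
  intros (H1 & H2 & H3); apply vec_eq; apply is_derive_unique; assumption.
Qed.

Lemma is_vderive_vpd2 (X : R -> R -> R3) (u v : R) (l : R3) :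
  is_vderive (fun s => X u s) v l -> vpd2 X u v = l.
Proof.
  intros (H1 & H2 & H3); apply vec_eq; apply is_derive_unique; assumption.
Qed.

Lemma smooth_field_vpd (D : R -> R -> Prop) (X : R -> R -> R3) (u v : R) :
  smooth_field D X -> D u v ->
  is_vderive (fun s => X s v) u (vpd1 X u v) /\
  is_vderive (fun s => X u s) v (vpd2 X u v).
Proof.
  intros (S1 & S2 & S3) Huv.
  destruct (S1 1%nat) as (_ & E1 & _), (S2 1%nat) as (_ & E2 & _), (S3 1%nat) as (_ & E3 & _).
  destruct (E1 u v Huv), (E2 u v Huv), (E3 u v Huv).
  split; (split; [|split]); apply Derive_correct; assumption.
Qed.

(** * The anisotropic mean curvature equation in orthogonal parameters *)

Lemma dirichlet_sphere_grad (n : R3) : cz n <> 0 ->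
  sphere_grad dirichlet_density n
  = plus (scal (- (1 + / (cz n * cz n))) e_z) (scal (/ cz n + cz n) n).
Proof.
  intros n0.
  assert (G : grad3 dirichlet_density n = scal (- (1 + / (cz n * cz n))) e_z).
  { apply vec_eq.
    - transitivity (Derive (fun _ : R => / cz n - cz n) (cx n)); [reflexivity|].
      rewrite Derive_const; unfold scal, cx; simpl; unfold scal; simpl; unfold mult; simpl; ring.
    - transitivity (Derive (fun _ : R => / cz n - cz n) (cy n)); [reflexivity|].
      rewrite Derive_const; unfold scal, cx, cy; simpl; unfold scal; simpl; unfold mult; simpl; ring.
    - apply is_derive_unique; unfold dirichlet_density.
      change (is_derive (fun s : R => / s - s) (cz n) (- (1 + / (cz n * cz n)) * 1)).
      auto_derive; [exact n0 | field; exact n0]. }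
  (* The Euclidean gradient is vertical, and its component along [n] is [- (cz n + / cz n)];
     removing that component produces the multiple of [n]. *)
  unfold sphere_grad; rewrite G, dot_scal_l, dot_comm, dot_e_z.
  f_equal; f_equal; field; exact n0.
Qed.

(* For tangent [T] the terms of the derivative along [n] drop out. *)
Lemma is_vderive_dirichlet_grad (N : R -> R3) (x : R) (N' : R3) :
  is_vderive N x N' -> locally x (fun s => cz (N s) <> 0) ->
  exists W', is_vderive (fun s => sphere_grad dirichlet_density (N s)) x W' /\
    forall T, dot (N x) T = 0 ->
      dot W' T = (/ cz (N x) + cz (N x)) * dot N' T
                 + 2 * cz N' * cz T / cz (N x) ^ 3.
Proof.
  intros HN H0; pose proof (locally_singleton _ _ H0) as n0.
  destruct (HN) as (_ & _ & Hz).
  assert (A : is_derive (fun s => - (1 + / (cz (N s) * cz (N s)))) x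
                (2 * cz N' / cz (N x) ^ 3)).
  { apply (is_derive_comp (fun z => - (1 + / (z * z))) (fun s => cz (N s)) x
             (2 / cz (N x) ^ 3) (cz N')) in Hz.
    - replace (2 * cz N' / cz (N x) ^ 3) with (scal (cz N') (2 / cz (N x) ^ 3)); [exact Hz|].
      unfold scal; simpl; unfold mult; simpl; field; exact n0.
    - auto_derive; [nra | field; exact n0]. }
  assert (B : is_derive (fun s => / cz (N s) + cz (N s)) x
                (cz N' * (1 - / cz (N x) ^ 2))).
  { apply (is_derive_comp (fun z => / z + z) (fun s => cz (N s)) x
             (1 - / cz (N x) ^ 2) (cz N')) in Hz; [exact Hz|].
    auto_derive; [exact n0 | field; exact n0]. }
  eexists; split.
  (* The closed form of the gradient holds only where the normal is not horizontal, hence only for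
     [s] near [x]. *)
  - eapply is_vderive_ext_loc.
    + eapply filter_imp; [|exact H0]; intros s Hs; symmetry; exact (dirichlet_sphere_grad _ Hs).
    + exact (is_vderive_plus _ _ _ _ _
        (is_vderive_scal _ _ _ _ _ A (is_vderive_const e_z x)) (is_vderive_scal _ _ _ _ _ B HN)).
  - intros T nT; rewrite !dot_plus_l, !dot_scal_l, nT, (dot_comm e_z), dot_e_z.
    rewrite (dot_comm zero), dot_zero_r.
    unfold Rdiv; ring.
Qed.

Lemma open_slices (D : R -> R -> Prop) (u v : R) :
  open (fun q : R * R => D (fst q) (snd q)) -> D u v ->
  locally u (fun s => D s v) /\ locally v (fun t => D u t).
Proof.
  intros O Huv; destruct (O (u, v) Huv) as [e He]; split; exists e; intros y Hy;
    apply (He (_, _)); split; simpl; auto using ball_center.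
Qed.

Lemma surface_div_orthogonal (X W : R -> R -> R3) (u v : R) :
  dot (vpd1 X u v) (vpd2 X u v) = 0 ->
  dot (vpd1 X u v) (vpd1 X u v) <> 0 -> dot (vpd2 X u v) (vpd2 X u v) <> 0 ->
  surface_div X W u v
  = dot (vpd1 W u v) (vpd1 X u v) / dot (vpd1 X u v) (vpd1 X u v)
    + dot (vpd2 W u v) (vpd2 X u v) / dot (vpd2 X u v) (vpd2 X u v).
Proof.
  intros g12 g11 g22; unfold surface_div; rewrite g12; field; auto.
Qed.

Lemma cross_neq0 (v w : R3) : cross v w <> zero -> dot v v <> 0 /\ dot w w <> 0.
Proof.
  intros H; split; intros E; apply dot_self_eq0 in E; subst; apply H; apply vec_eq;
    unfold cross, cx, cy, cz, zero; simpl; unfold zero; simpl; ring.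
Qed.

(** Write [z] for the height of the normal and [T] for the trace of its differential. Then
    [2 H F = - T (1/z - z)], while the divergence of the gradient is [T (1/z + z)] plus [2/z^3]
    times the sum of the height products. The terms in [z T] cancel, and multiplying by [z^3] clears
    the denominators. *)
Lemma dirichlet_CAMC_orthogonal (D : R -> R -> Prop) (X nu : R -> R -> R3) (Lambda u v : R) :
  oriented_immersion D X nu -> dirichlet_CAMC D X nu Lambda -> D u v ->
  dot (vpd1 X u v) (vpd2 X u v) = 0 ->
  let X1 := vpd1 X u v in let X2 := vpd2 X u v in
  let n1 := vpd1 nu u v in let n2 := vpd2 nu u v in
  Lambda * cz (nu u v) ^ 3
  = - 2 * cz (nu u v) ^ 2 * (dot n1 X1 / dot X1 X1 + dot n2 X2 / dot X2 X2)
    - 2 * (cz n1 * cz X1 / dot X1 X1 + cz n2 * cz X2 / dot X2 X2).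
Proof.
  intros (O & _ & Hcross & Snu & Hnu) C Huv g12 X1 X2 n1 n2.
  destruct (cross_neq0 _ _ (Hcross u v Huv)) as [g11 g22].
  destruct (Hnu u v Huv) as (_ & nX1 & nX2), (C u v Huv) as [z0 HL].
  destruct (open_slices D u v O Huv) as [O1 O2].
  destruct (smooth_field_vpd D nu u v Snu Huv) as [V1 V2].
  destruct (is_vderive_dirichlet_grad (fun s => nu s v) u _ V1) as (W1 & HW1 & E1).
  (* The CAMC hypothesis gives a nonzero height at all points of [D], and the slices of [D] are
     open. *)
  { eapply filter_imp; [|exact O1]; intros s Hs; apply (C s v Hs). }
  destruct (is_vderive_dirichlet_grad (fun s => nu u s) v _ V2) as (W2 & HW2 & E2).
  { eapply filter_imp; [|exact O2]; intros s Hs; apply (C u s Hs). }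
  rewrite <- HL; unfold aniso_mean_curvature, mean_curvature.
  rewrite !surface_div_orthogonal by assumption.
  rewrite (is_vderive_vpd1 (fun s t => sphere_grad dirichlet_density (nu s t)) u v W1 HW1).
  rewrite (is_vderive_vpd2 (fun s t => sphere_grad dirichlet_density (nu s t)) u v W2 HW2).
  rewrite E1, E2 by assumption.
  unfold dirichlet_density; fold X1 X2 n1 n2; fold X1 in g11; fold X2 in g22; field; auto.
Qed.

(** * Algebra along one parallel: the cubic and the shape of the surface *)

(* The hypothesis is a cubic in [cos phi], sampled at four points. Its leading
   coefficient gives [Lambda = 0]; the coefficients of the remaining quadratic
   give [ka = k al^2] and [al a3 = 0], and then [k c^2 = 0]. *)
Lemma revolution_cubic (Lambda al mu ka k a3 c : R) :
  0 < c -> mu <> 0 -> k <> 0 -> al * al + mu * mu = 1 ->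
  (forall phi, let x := c * cos phi in let y := - c * sin phi in
     Lambda * (al * a3 + mu * x) ^ 3
     = - 2 * (al * a3 + mu * x) ^ 2 * (ka + k)
       - 2 * (ka * (mu * a3 - al * x) ^ 2 + k * y ^ 2)) -> False.
Proof.
  intros c0 mu0 k0 am H.
  pose proof (H 0) as H0; pose proof (H PI) as H1;
    pose proof (H (PI / 2)) as H2; pose proof (H (PI / 3)) as H3; clear H.
  cbv zeta in *.
  rewrite cos_0, sin_0 in H0; rewrite cos_PI, sin_PI in H1;
    rewrite cos_PI2, sin_PI2 in H2.
  (* Only the square of the sine occurs, so no square root of three enters. At all four samples
     [y^2 = c^2 - x^2], with [x] equal to [c], [-c], [0] and [c/2]. *)
  replace ((- c * sin (PI / 3)) ^ 2) with (c ^ 2 * (1 - (1 / 2) ^ 2)) in H3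
    by (pose proof (sin2_cos2 (PI / 3)) as T; rewrite cos_PI3 in T; unfold Rsqr in T; nra).
  rewrite cos_PI3 in H3.
  assert (L : Lambda * (mu ^ 3 * c ^ 3) = 0) by lra.
  assert (L0 : Lambda = 0).
  { apply Rmult_integral in L; destruct L as [L | L]; [exact L|].
    exfalso; revert L; apply Rmult_integral_contrapositive; split; apply pow_nonzero; lra. }
  subst Lambda; clear L.
  assert (Q2 : c * c * ((ka + k) * (mu * mu) + ka * (al * al) - k) = 0) by lra.
  assert (Q1 : c * ((ka + k) * (al * a3 * mu) - ka * (mu * a3 * al)) = 0) by lra.
  assert (Q0 : (ka + k) * (al * a3) ^ 2 + ka * (mu * a3) ^ 2 + k * c ^ 2 = 0) by lra.
  apply Rmult_integral in Q2; destruct Q2 as [Q2 | Q2]; [nra|].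
  apply Rmult_integral in Q1; destruct Q1 as [Q1 | Q1]; [lra|].
  assert (Z : (k * mu) * (al * a3) = 0) by lra.
  apply Rmult_integral in Z; destruct Z as [Z | Z].
  { apply Rmult_integral in Z; tauto. }
  assert (K : ka = k * (al * al)).
  { replace (k * (al * al)) with (k * (1 - mu * mu)) by (rewrite <- am; ring).
    replace ka with (ka * (al * al + mu * mu)) by (rewrite am; ring). lra. }
  rewrite Z, K in Q0.
  replace ((k * (al * al) + k) * 0 ^ 2 + k * (al * al) * (mu * a3) ^ 2 + k * c ^ 2)
    with (k * (mu * mu * (al * a3) ^ 2 + c ^ 2)) in Q0 by ring.
  rewrite Z in Q0; apply Rmult_integral in Q0; destruct Q0 as [Q0 | Q0]; [tauto | nra].
Qed.

(* In the plane spanned by [a] and [m] both [n1] and the tangent [t1 a + r1 m]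
   are multiples of the vector [(n.m) a - (n.a) m] orthogonal to [n]. *)
Lemma revolution_shape (a m q n n1 n2 : R3) (t1 r1 t2 r2 r : R) :
  orthonormal a m q -> 0 < r -> t1 <> 0 ->
  dot n n = 1 -> dot n1 n = 0 -> dot n2 n = 0 ->
  dot n q = 0 -> dot n1 q = 0 -> dot n2 q = dot n m ->
  t1 * dot n a + r1 * dot n m = 0 ->
  t1 * dot n1 a + r1 * dot n1 m = - (t2 * dot n a + r2 * dot n m) ->
  t1 * dot n2 a + r1 * dot n2 m = 0 ->
  let X1 := plus (scal t1 a) (scal r1 m) in let X2 := scal r q in
  let al := dot n a in let mu := dot n m in
  let ka := - (t2 * al + r2 * mu) / (t1 ^ 2 + r1 ^ 2) in
  (al * al + mu * mu = 1 /\ mu <> 0) /\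
  (dot n2 a = 0 /\ dot n2 m = 0) /\
  cz n = al * cz a + mu * cz m /\
  (dot n1 X1 / dot X1 X1 = ka /\ dot n2 X2 / dot X2 X2 = mu / r) /\
  (cz n1 * cz X1 / dot X1 X1 = ka * (mu * cz a - al * cz m) ^ 2 /\
   cz n2 * cz X2 / dot X2 X2 = mu / r * cz q ^ 2).
Proof.
  intros F r0 t0 nn n1n n2n nq n1q n2q nX n1X n2X X1 X2 al mu ka.
  rewrite (parseval _ _ _ n n F), nq in nn.
  rewrite (parseval _ _ _ n1 n F), nq in n1n; rewrite (parseval _ _ _ n2 n F), nq in n2n.
  assert (Z : forall v, cz v = dot v a * cz a + dot v m * cz m + dot v q * cz q).
  { intros v; rewrite <- !dot_e_z, (parseval _ _ _ v e_z F), !(dot_comm e_z); ring. }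
  pose proof (Z n) as Zn; pose proof (Z n1) as Zn1; pose proof (Z n2) as Zn2.
  rewrite nq in Zn; rewrite n1q in Zn1; rewrite n2q in Zn2; clear Z.
  destruct F as (aa & mm & qq & am & aq & mq).
  fold al mu in nn, n1n, n2n, nX, n1X, Zn, Zn2, n2q.
  assert (nn' : al * al + mu * mu = 1) by lra.
  set (be := dot n1 a) in *; set (ga := dot n1 m) in *.
  assert (w0 : 0 < t1 ^ 2 + r1 ^ 2) by nra.
  (* Coordinate of the profile tangent along [mu a - al m], the quarter turn of [n] in the plane of
     [a] and [m]; [la] below is the same coordinate for [n1]. Thus [ka] becomes the ratio
     [la / tau]. *)
  set (tau := t1 * mu - r1 * al).
  assert (T1 : t1 = tau * mu).
  { unfold tau; transitivity (t1 * (al * al + mu * mu) - al * (t1 * al + r1 * mu));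
      [rewrite nn', nX | ]; ring. }
  assert (R1 : r1 = - tau * al).
  { unfold tau; transitivity (r1 * (al * al + mu * mu) - mu * (t1 * al + r1 * mu));
      [rewrite nn', nX | ]; ring. }
  assert (mu0 : mu <> 0) by (intros E; apply t0; rewrite T1, E; ring).
  assert (tau0 : tau <> 0) by (intros E; apply t0; rewrite T1, E; ring).
  assert (W : t1 ^ 2 + r1 ^ 2 = tau ^ 2).
  { rewrite T1, R1; transitivity (tau ^ 2 * (al * al + mu * mu)); [| rewrite nn']; ring. }
  set (la := be * mu - ga * al).
  assert (B1 : be = la * mu).
  { unfold la; transitivity (be * (al * al + mu * mu) - al * (be * al + ga * mu));
      [rewrite nn'|ring]. replace (be * al + ga * mu) with 0 by lra. ring. }
  assert (G1 : ga = - la * al).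
  { unfold la; transitivity (ga * (al * al + mu * mu) - mu * (be * al + ga * mu));
      [rewrite nn'|ring]. replace (be * al + ga * mu) with 0 by lra. ring. }
  assert (K : ka = la / tau).
  { unfold ka; rewrite W, <- n1X, B1, G1, T1, R1.
    transitivity (la * (al * al + mu * mu) / tau); [field; exact tau0 | rewrite nn'; field; exact tau0]. }
  set (be2 := dot n2 a) in *; set (ga2 := dot n2 m) in *.
  (* The projection of [n2] to the plane of [a] and [m] is orthogonal both to [n] and to the profile
     tangent, which span that plane, so it vanishes. *)
  assert (orth : mu * be2 - al * ga2 = 0).
  { rewrite T1, R1 in n2X; apply (Rmult_eq_reg_l tau); [|exact tau0]; lra. }
  assert (Be : be2 = 0).
  { transitivity (be2 * (al * al + mu * mu)); [rewrite nn'; ring|].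
    transitivity (al * (be2 * al + ga2 * mu) + mu * (mu * be2 - al * ga2)); [ring|].
    rewrite orth; replace (be2 * al + ga2 * mu) with 0 by lra; ring. }
  assert (Ga : ga2 = 0).
  { transitivity (ga2 * (al * al + mu * mu)); [rewrite nn'; ring|].
    transitivity (mu * (be2 * al + ga2 * mu) - al * (mu * be2 - al * ga2)); [ring|].
    rewrite orth; replace (be2 * al + ga2 * mu) with 0 by lra; ring. }
  assert (g11 : dot X1 X1 = tau ^ 2).
  { unfold X1; rewrite !dot_plus_r, !dot_plus_l, !dot_scal_r, !dot_scal_l, (dot_comm m a),
      aa, mm, am, <- W; ring. }
  assert (g22 : dot X2 X2 = r ^ 2) by (unfold X2; rewrite dot_scal_r, dot_scal_l, qq; ring).
  assert (Z1 : cz X1 = tau * (mu * cz a - al * cz m)).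
  { transitivity (t1 * cz a + r1 * cz m); [reflexivity | rewrite T1, R1; ring]. }
  assert (Z2 : cz X2 = r * cz q) by reflexivity.
  rewrite g11, g22, Z1, Z2, Zn1, Zn2, K.
  split; [auto|]; split; [auto|]; split; [lra|]; split; split.
  - unfold X1; rewrite dot_plus_r, !dot_scal_r; fold be ga; rewrite B1, G1, T1, R1.
    transitivity (la * (al * al + mu * mu) / tau); [field; exact tau0 | rewrite nn'; field; exact tau0].
  - unfold X2; rewrite dot_scal_r, n2q; field; lra.
  - rewrite B1, G1; field; exact tau0.
  - rewrite Be, Ga; field; lra.
Qed.

(** * Constancy via derivatives, and the rotating frame *)

Lemma is_derive_locally_const (f : R -> R) (x k l : R) :
  locally x (fun s => f s = k) -> is_derive f x l -> l = 0.
Proof.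
  intros E H; rewrite <- (is_derive_unique _ _ _ H).
  transitivity (Derive (fun _ => k) x); [apply Derive_ext_loc, E | apply Derive_const].
Qed.

Lemma derive_zero_const (f : R -> R) : (forall x, is_derive f x 0) -> forall x y, f x = f y.
Proof.
  intros H x y; destruct (Rtotal_order x y) as [L | [-> | L]]; [| reflexivity | symmetry];
    apply (eq_is_derive f); try exact L; intros; apply H.
Qed.

(** For orthonormal [b] and [c], these are the unit vectors pointing away from the axis and along
    the parallel at angle [th]. They are differentiated through [radial' = angular] and
    [angular' = - radial]. *)
Definition radial (b c : R3) (th : R) : R3 := plus (scal (cos th) b) (scal (sin th) c).
Definition angular (b c : R3) (th : R) : R3 := plus (scal (- sin th) b) (scal (cos th) c).

Ltac vec_ring :=
  apply vec_eq; unfold radial, angular, cx, cy, cz, plus, scal, zero, opp; simpl;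
  unfold plus, scal, zero, opp; simpl; unfold mult; simpl; ring.

Lemma is_vderive_combination (f g : R -> R) (v w : R3) (x f' g' : R) :
  is_derive f x f' -> is_derive g x g' ->
  is_vderive (fun s => plus (scal (f s) v) (scal (g s) w)) x (plus (scal f' v) (scal g' w)).
Proof.
  intros Hf Hg.
  replace (plus (scal f' v) (scal g' w)) with
    (plus (plus (scal f' v) (scal (f x) zero)) (plus (scal g' w) (scal (g x) zero))) by vec_ring.
  apply is_vderive_plus; apply is_vderive_scal; auto using is_vderive_const.
Qed.

Lemma is_vderive_radial (b c : R3) (th : R) :
  is_vderive (radial b c) th (angular b c th).
Proof.
  exact (is_vderive_combination cos sin b c th _ _ (is_derive_cos th) (is_derive_sin th)).
Qed.

Lemma is_vderive_angular (b c : R3) (th : R) :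
  is_vderive (angular b c) th (scal (-1) (radial b c th)).
Proof.
  replace (scal (-1) (radial b c th)) with (plus (scal (- cos th) b) (scal (- sin th) c))
    by vec_ring.
  exact (is_vderive_combination (fun x => - sin x) cos b c th _ _
           (is_derive_opp _ _ _ (is_derive_sin th)) (is_derive_cos th)).
Qed.

(** * CAMC surfaces of revolution: the profile of a tilted one is flat *)

Section Revolution.

Variables (D : R -> R -> Prop) (X nu : R -> R -> R3) (Lambda : R).
Variables (p a e1 e2 : R3) (I : R -> Prop) (r t : R -> R).
Hypothesis Hsurf : oriented_immersion D X nu.
Hypothesis Hcamc : dirichlet_CAMC D X nu Lambda.
Hypothesis frame : orthonormal a e1 e2.
Hypothesis profile : forall s, I s ->
  (forall n : nat, ex_derive_n r n s /\ ex_derive_n t n s) /\ 0 < r s.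
Hypothesis domain : forall s th, D s th <-> I s.
Hypothesis param : forall s th, I s ->
  X s th = plus p (plus (scal (t s) a)
             (plus (scal (r s * cos th) e1) (scal (r s * sin th) e2))).

Let m := radial e1 e2.
Let q := angular e1 e2.

Lemma profile_derive (s : R) : I s ->
  (is_derive r s (Derive r s) /\ is_derive t s (Derive t s)) /\
  (is_derive (Derive r) s (Derive (Derive r) s) /\ is_derive (Derive t) s (Derive (Derive t) s)).
Proof.
  intros Is; destruct (proj1 (profile s Is) 1%nat) as [R1 T1],
    (proj1 (profile s Is) 2%nat) as [R2 T2].
  repeat split; apply Derive_correct; assumption.
Qed.

(** The openness of [I] is read off from that of [D] along the slice at angle [0]. *)
Lemma domain_locally (s : R) : I s -> locally s I.
Proof.
  intros Is; destruct (open_slices D s 0 (proj1 Hsurf)) as [L _]; [now apply domain|].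
  eapply filter_imp; [|exact L]; intros y; apply domain.
Qed.

Lemma revolution_vpd1 (s th : R) : I s ->
  vpd1 X s th = plus (scal (Derive t s) a) (scal (Derive r s) (m th)).
Proof.
  intros Is; destruct (profile_derive s Is) as [[Hr Ht] _].
  apply is_vderive_vpd1.
  apply is_vderive_ext_loc with
    (V := fun s => plus p (plus (scal (t s) a) (scal (r s) (m th)))).
  - eapply filter_imp; [|exact (domain_locally s Is)].
    intros y Iy; rewrite (param y th Iy); unfold m; vec_ring.
  - replace (plus (scal (Derive t s) a) (scal (Derive r s) (m th))) with
      (plus zero (plus (scal (Derive t s) a) (scal (Derive r s) (m th)))) by vec_ring.
    apply is_vderive_plus; [apply is_vderive_const | now apply is_vderive_combination].
Qed.

Lemma revolution_vpd2 (s th : R) : I s -> vpd2 X s th = scal (r s) (q th).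
Proof.
  intros Is; apply is_vderive_vpd2.
  apply is_vderive_ext_loc with
    (V := fun th => plus (plus p (scal (t s) a)) (scal (r s) (m th))).
  - apply filter_forall; intros y; rewrite (param s y Is); unfold m; vec_ring.
  - replace (scal (r s) (q th)) with
      (plus zero (plus (scal 0 (m th)) (scal (r s) (q th)))) by (unfold m, q; vec_ring).
    apply is_vderive_plus; [apply is_vderive_const|].
    exact (is_vderive_scal (fun _ => r s) (radial e1 e2) th 0 _
             (is_derive_const _ _) (is_vderive_radial e1 e2 th)).
Qed.

Lemma revolution_normal (s th : R) : I s ->
  dot (nu s th) (nu s th) = 1 /\
  dot (nu s th) (plus (scal (Derive t s) a) (scal (Derive r s) (m th))) = 0 /\
  dot (nu s th) (q th) = 0.
Proof.
  intros Is; destruct Hsurf as (_ & _ & _ & _ & Hnu).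
  destruct (Hnu s th (proj2 (domain s th) Is)) as (nn & n1 & n2).
  rewrite revolution_vpd1 in n1 by exact Is; rewrite revolution_vpd2, dot_scal_r in n2 by exact Is.
  pose proof (proj2 (profile s Is)); repeat split; try assumption.
  apply Rmult_integral in n2; destruct n2; [lra | assumption].
Qed.

(** Each identity comes from differentiating one of the relations of [revolution_normal] along the
    profile or along the parallel. Along the parallel, [q' = - m] turns [n.q = 0] into [n2.q = n.m],
    and the tangent [t' a + r' m] has derivative [r' q], which is orthogonal to [n]. *)
Lemma revolution_normal_derive (s th : R) : I s ->
  let n := nu s th in let n1 := vpd1 nu s th in let n2 := vpd2 nu s th in
  (dot n1 n = 0 /\ dot n2 n = 0) /\ (dot n1 (q th) = 0 /\ dot n2 (q th) = dot n (m th)) /\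
  Derive t s * dot n1 a + Derive r s * dot n1 (m th)
    = - (Derive (Derive t) s * dot n a + Derive (Derive r) s * dot n (m th)) /\
  Derive t s * dot n2 a + Derive r s * dot n2 (m th) = 0.
Proof.
  intros Is n n1 n2; pose proof Hsurf as (O & _ & _ & Snu & _).
  destruct (smooth_field_vpd D nu s th Snu (proj2 (domain s th) Is)) as [V1 V2].
  fold n1 in V1; fold n2 in V2.
  destruct (profile_derive s Is) as [_ [Hr Ht]].
  pose proof (domain_locally s Is) as L.
  destruct (revolution_normal s th Is) as (_ & _ & nq).
  assert (A1 : dot n1 n = 0).
  { pose proof (is_vderive_dot _ _ _ _ _ V1 V1) as E; cbv beta in E; fold n in E.
    apply (is_derive_locally_const _ _ 1) in E; [rewrite (dot_comm n) in E; lra|].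
    eapply filter_imp; [|exact L]; intros y Iy; apply (revolution_normal y th Iy). }
  assert (A2 : dot n2 n = 0).
  { pose proof (is_vderive_dot _ _ _ _ _ V2 V2) as E; cbv beta in E; fold n in E.
    apply (is_derive_locally_const _ _ 1) in E; [rewrite (dot_comm n) in E; lra|].
    apply filter_forall; intros y; apply (revolution_normal s y Is). }
  assert (B1 : dot n1 (q th) = 0).
  { pose proof (is_vderive_dot _ _ _ _ _ V1 (is_vderive_const (q th) s)) as E.
    apply (is_derive_locally_const _ _ 0) in E.
    - rewrite dot_zero_r in E; lra.
    - eapply filter_imp; [|exact L]; intros y Iy; apply (revolution_normal y th Iy). }
  assert (B2 : dot n2 (q th) = dot n (m th)).
  { pose proof (is_vderive_dot _ _ _ _ _ V2 (is_vderive_angular e1 e2 th)) as E.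
    apply (is_derive_locally_const _ _ 0) in E.
    - rewrite dot_scal_r in E; fold n m q in E; lra.
    - apply filter_forall; intros y; apply (revolution_normal s y Is). }
  assert (C1 : Derive t s * dot n1 a + Derive r s * dot n1 (m th)
    = - (Derive (Derive t) s * dot n a + Derive (Derive r) s * dot n (m th))).
  { pose proof (is_vderive_dot _ _ _ _ _ V1
      (is_vderive_combination _ _ a (m th) _ _ _ Ht Hr)) as E.
    apply (is_derive_locally_const _ _ 0) in E.
    - rewrite !dot_plus_r, !dot_scal_r in E; fold n in E; lra.
    - eapply filter_imp; [|exact L]; intros y Iy; apply (revolution_normal y th Iy). }
  assert (C2 : Derive t s * dot n2 a + Derive r s * dot n2 (m th) = 0).
  { pose proof (is_vderive_dot _ _ _ _ _ V2
      (is_vderive_plus _ _ _ _ _ (is_vderive_const (scal (Derive t s) a) th)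
        (is_vderive_scal (fun _ => Derive r s) _ _ _ _
           (is_derive_const _ _) (is_vderive_radial e1 e2 th)))) as E.
    apply (is_derive_locally_const _ _ 0) in E.
    - fold n in nq; fold m q n in E; rewrite !dot_plus_r, !dot_scal_r, nq in E.
      rewrite dot_zero_r in E; change (zero : R) with 0 in E; lra.
    - apply filter_forall; intros y; apply (revolution_normal s y Is). }
  auto.
Qed.

Lemma revolution_shape_at (s th : R) : I s -> Derive t s <> 0 ->
  let X1 := vpd1 X s th in let X2 := vpd2 X s th in
  let n1 := vpd1 nu s th in let n2 := vpd2 nu s th in
  let al := dot (nu s th) a in let mu := dot (nu s th) (m th) in
  let ka := - (Derive (Derive t) s * al + Derive (Derive r) s * mu)
            / (Derive t s ^ 2 + Derive r s ^ 2) in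
  (al * al + mu * mu = 1 /\ mu <> 0) /\
  (dot n2 a = 0 /\ dot n2 (m th) = 0) /\
  cz (nu s th) = al * cz a + mu * cz (m th) /\
  (dot n1 X1 / dot X1 X1 = ka /\ dot n2 X2 / dot X2 X2 = mu / r s) /\
  (cz n1 * cz X1 / dot X1 X1 = ka * (mu * cz a - al * cz (m th)) ^ 2 /\
   cz n2 * cz X2 / dot X2 X2 = mu / r s * cz (q th) ^ 2).
Proof.
  intros Is t0; cbv zeta; rewrite revolution_vpd1, revolution_vpd2 by exact Is.
  destruct (revolution_normal s th Is) as (nn & nX & nq).
  destruct (revolution_normal_derive s th Is) as ((n1n & n2n) & (n1q & n2q) & n1X & n2X).
  rewrite dot_plus_r, !dot_scal_r in nX.
  apply revolution_shape; try assumption.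
  - exact (rotate_orthonormal a e1 e2 th frame).
  - exact (proj2 (profile s Is)).
Qed.

Lemma revolution_profile_flat (s : R) : I s -> cz e1 <> 0 \/ cz e2 <> 0 -> Derive t s = 0.
Proof.
  intros Is tilt; apply NNPP; intros t0.
  pose proof (proj2 (profile s Is)) as r0.
  assert (S := fun th => revolution_shape_at s th Is t0); cbv zeta in S.
  (* Along the parallel, [n.a] has derivative [n2.a = 0], and in [CM] the function [n.m] has
     derivative [n2.m + n.q = 0]. *)
  assert (CA : forall th, dot (nu s th) a = dot (nu s 0) a).
  { intros th; apply (derive_zero_const (fun y => dot (nu s y) a)); clear th; intros th.
    pose proof Hsurf as (_ & _ & _ & Snu & _).
    destruct (smooth_field_vpd D nu s th Snu (proj2 (domain s th) Is)) as [_ V2].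
    pose proof (is_vderive_dot _ _ _ _ _ V2 (is_vderive_const a th)) as E.
    destruct (S th) as (_ & (E1 & _) & _); cbv beta in E; rewrite E1 in E.
    rewrite dot_zero_r, Rplus_0_r in E; exact E. }
  assert (CM : forall th, dot (nu s th) (m th) = dot (nu s 0) (m 0)).
  { intros th; apply (derive_zero_const (fun y => dot (nu s y) (m y))); clear th; intros th.
    pose proof Hsurf as (_ & _ & _ & Snu & _).
    destruct (smooth_field_vpd D nu s th Snu (proj2 (domain s th) Is)) as [_ V2].
    pose proof (is_vderive_dot _ _ _ _ _ V2 (is_vderive_radial e1 e2 th)) as E.
    destruct (S th) as (_ & (_ & E1) & _); cbv beta in E; fold m q in E; rewrite E1 in E.
    destruct (revolution_normal s th Is) as (_ & _ & nq); rewrite nq, Rplus_0_r in E; exact E. }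
  (* [c] is the sine of the angle between the axis and the vertical. Measuring angles from [th0],
     the direction in which the radial vector is highest, gives [m] the height [c cos phi] and [q]
     the height [- c sin phi]. *)
  set (c := sqrt (cz e1 * cz e1 + cz e2 * cz e2)).
  assert (cc : 0 < cz e1 * cz e1 + cz e2 * cz e2) by (destruct tilt; nra).
  destruct (polar_angle (cz e1) (cz e2) c) as (th0 & P1 & P2).
  { apply sqrt_lt_R0, cc. }
  { symmetry; apply sqrt_sqrt; lra. }
  destruct (S 0) as ((am & mu0) & _).
  set (al := dot (nu s 0) a) in *; set (mu := dot (nu s 0) (m 0)) in *.
  apply (revolution_cubic Lambda al mu
    (- (Derive (Derive t) s * al + Derive (Derive r) s * mu) / (Derive t s ^ 2 + Derive r s ^ 2))
    (mu / r s) (cz a) c); try assumption.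
  - apply sqrt_lt_R0, cc.
  - intros E; apply mu0; replace mu with (mu / r s * r s) by (field; lra); rewrite E; ring.
  - intros phi x y.
    pose proof (dirichlet_CAMC_orthogonal D X nu Lambda s (th0 + phi) Hsurf Hcamc
      (proj2 (domain _ _) Is)) as E.
    destruct (S (th0 + phi)) as (_ & _ & Zn & (K1 & K2) & (Z1 & Z2)).
    cbv zeta in E; rewrite K1, K2, Z1, Z2, Zn, CA, CM in E.
    replace (cz (m (th0 + phi))) with x in E.
    2:{ transitivity (cos (th0 + phi) * cz e1 + sin (th0 + phi) * cz e2); [|reflexivity].
        rewrite cos_plus, sin_plus, P1, P2; unfold x.
        pose proof (sin2_cos2 th0) as T; unfold Rsqr in T.
        transitivity (c * cos phi * (sin th0 * sin th0 + cos th0 * cos th0));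
          [rewrite T|]; ring. }
    replace (cz (q (th0 + phi))) with y in E.
    2:{ transitivity (- sin (th0 + phi) * cz e1 + cos (th0 + phi) * cz e2); [|reflexivity].
        rewrite cos_plus, sin_plus, P1, P2; unfold y.
        pose proof (sin2_cos2 th0) as T; unfold Rsqr in T.
        transitivity (- c * sin phi * (sin th0 * sin th0 + cos th0 * cos th0));
          [rewrite T|]; ring. }
    (* What remains is the orthogonality of meridians and parallels. *)
    apply E; rewrite revolution_vpd1, revolution_vpd2 by exact Is.
    destruct (rotate_orthonormal a e1 e2 (th0 + phi) frame) as (_ & _ & _ & _ & aq & mq).
    rewrite dot_scal_r, dot_plus_l, !dot_scal_l.
    change (dot a (q (th0 + phi)) = 0) in aq.
    change (dot (m (th0 + phi)) (q (th0 + phi)) = 0) in mq.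
    rewrite aq, mq; ring.
Qed.

End Revolution.

(** * From the flat profile to the direction of the axis *)

Theorem theorem1p6 (D : R -> R -> Prop) (X nu : R -> R -> R3) (Lambda : R)
    (p a : R3)
    (Hsurf : oriented_immersion D X nu)
    (Hcamc : dirichlet_CAMC D X nu Lambda)
    (Hrev : surface_of_revolution p a D X)
    (* a plane that is not horizontal is a CAMC surface with [Lambda = 0], and a
       surface of revolution about each of its normal lines *)
    (Hplane : forall (n : R3) (d : R), lies_in_plane D X n d -> parallel n e_z) :
  parallel a e_z.
Proof.
  destruct Hrev as (lo & hi & e1 & e2 & r & t & lohi & frame & profile & domain & param).
  (* The axis is vertical exactly when [e1] and [e2] are both horizontal. *)
  destruct (classic (cz e1 <> 0 \/ cz e2 <> 0)) as [tilt | vert].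
  - assert (flat : forall s : R, Rbar_lt lo s /\ Rbar_lt s hi -> is_derive t s 0).
    { intros s Is.
      rewrite <- (revolution_profile_flat D X nu Lambda p a e1 e2
        (fun s : R => Rbar_lt lo s /\ Rbar_lt s hi) r t Hsurf Hcamc frame
        (fun s Is => conj (proj1 (profile s Is)) (proj1 (proj2 (profile s Is))))
        domain param s Is tilt).
      apply Derive_correct, (proj2 (proj1 (profile s Is) 1%nat)). }
    assert (const : forall s s' : R, Rbar_lt lo s /\ Rbar_lt s hi -> Rbar_lt lo s' /\ Rbar_lt s' hi ->
              s < s' -> t s = t s').
    { intros s s' [Is _] [_ Is'] L; apply (eq_is_derive t); [|exact L].
      intros y [y1 y2]; apply flat; split.
      - exact (Rbar_lt_le_trans lo s y Is y1).
      - exact (Rbar_le_lt_trans y s' hi y2 Is'). }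
    destruct (classic (exists s : R, Rbar_lt lo s /\ Rbar_lt s hi)) as [[s0 I0] | empty].
    (* With [t] constant the whole surface has the same coordinate along the axis, so it lies in a
       plane with normal [a]. *)
    + apply (Hplane a (dot a p + t s0)); split.
      { intros a0; destruct frame as (aa & _); rewrite a0, dot_zero_r in aa; lra. }
      intros s th Hs; apply domain in Hs; rewrite (param s th Hs).
      destruct frame as (aa & _ & _ & ab & ac & _).
      rewrite !dot_plus_r, !dot_scal_r, aa, ab, ac.
      replace (t s) with (t s0); [ring|].
      destruct (Rtotal_order s s0) as [L | [-> | L]]; [symmetry | reflexivity |]; auto.
    (* Without parameter values the plane condition is vacuous, and any offset serves. *)
    + apply (Hplane a 0); split.
      { intros a0; destruct frame as (aa & _); rewrite a0, dot_zero_r in aa; lra. }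
      intros s th Hs; apply domain in Hs; destruct empty; eauto.
  - assert (Z1 : cz e1 = 0) by (apply NNPP; tauto).
    assert (Z2 : cz e2 = 0) by (apply NNPP; tauto).
    (* Expanding the unit vector [e_z] in the frame gives [(cz a)^2 = 1]; as [a] is a unit vector,
       its horizontal components vanish. *)
    pose proof (parseval a e1 e2 e_z e_z frame) as P.
    rewrite (dot_comm e_z a), (dot_comm e_z e1), (dot_comm e_z e2), !dot_e_z, Z1, Z2 in P.
    change (cz e_z) with 1 in P.
    destruct frame as (aa & _); unfold dot in aa.
    exists (cz a); apply vec_eq; unfold e_z.
    + transitivity 0; [nra | unfold cx, scal; simpl; unfold scal; simpl; unfold mult; simpl; ring].
    + transitivity 0; [nra | unfold cx, cy, scal; simpl; unfold scal; simpl; unfold mult; simpl; ring].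
    + unfold cz, scal; simpl; unfold scal; simpl; unfold mult; simpl; ring.
Qed.
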